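(* Let $B_{\frac{\pi}{4},2}(0)=\{\Delta\in T_E\operatorname{St}(n,p):\|\Delta\|_2<\tfrac{\pi}{4}\}$. For any $t\in[0,1]$ and any $\xi\in B_{\frac{\pi}{4},2}(0)$, the matrix $U=\operatorname{Exp}_E^{\mathrm{Canon.}}(t\xi)\in\operatorname{St}(n,p)$ has a nonsingular upper $(p\times p)$ block with no eigenvalue equal to $-1$, where $\operatorname{Exp}_E^{\mathrm{Canon.}}$ is the Riemannian exponential map at $E$ under the canonical metric.
   Context: Let $p\le n$ be positive integers. $\operatorname{St}(n,p)=\{U\in\mathbb{R}^{n\times p}: U^TU=I_p\}$ is the Stiefel manifold and $E=\begin{bmatrix} I_p \\ 0 \end{bmatrix}\in\operatorname{St}(n,p)$. The tangent space $T_E\operatorname{St}(n,p)$ consists of all $\xi=\begin{bmatrix} A \\ B \end{bmatrix}$ with $A\in\mathbb{R}^{p\times p}$ skew-symmetric and $B\in\mathbb{R}^{(n-p)\times p}$. $\|\cdot\|_2$ is the spectral norm. The canonical metric is $g_c(\xi,\Delta)=\operatorname{tr}(\xi^T(I_n-\tfrac12UU^T)\Delta)$ on $T_U\operatorname{St}(n,p)$, and its Riemannian exponential at $E$ is $$\operatorname{Exp}_E^{\mathrm{Canon.}}\left(\begin{bmatrix} A \\ B \end{bmatrix}\right)=\exp_m\left(\begin{bmatrix} A & -B^T \\ B & 0 \end{bmatrix}\right)E,$$ where $\exp_m$ is the matrix exponential. *)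

(* Defs.v *)
From HB Require Import structures.
From mathcomp Require Export all_boot all_order all_algebra.
From mathcomp Require Export all_classical all_reals all_analysis.

Set Implicit Arguments.
Unset Strict Implicit.
Unset Printing Implicit Defensive.

Export Order.TTheory GRing.Theory Num.Theory.
Export numFieldNormedType.Exports.

Local Open Scope classical_set_scope.
Local Open Scope ring_scope.

Section MatrixAnalysis.
Variable R : realType.

Definition enorm (k : nat) (x : 'cV[R]_k) : R :=
  Num.sqrt (\sum_(i < k) x i 0 ^+ 2).

(* The library norm `|M| on matrices is the entrywise maximum; the spectral
   norm is the operator norm induced by the Euclidean norms. *)
Definition spectral_norm (k l : nat) (M : 'M[R]_(k, l)) : R :=
  sup [set enorm (M *m x) | x in [set x : 'cV[R]_l | enorm x <= 1]].

(* Limit of the partial sums in the (entrywise) topology of 'M[R]_k. *)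
Definition expm (k : nat) (X : 'M[R]_k) : 'M[R]_k :=
  limn (series (fun j => (j`!%:R)^-1 *: X ^+ j)).

End MatrixAnalysis.

Section Stiefel.
Variable R : realType.

Definition stiefel (n p : nat) : set 'M[R]_(n, p) :=
  [set U | U^T *m U = 1%:M].

(* From here on n = p + m, so that m = n - p and the blocks of an n x p matrix
   are its usubmx (p x p) and its dsubmx (m x p). *)
Variables p m : nat.

Definition stiefelE : 'M[R]_(p + m, p) := col_mx 1%:M 0.

Definition tangentE : set 'M[R]_(p + m, p) :=
  [set xi | exists (A : 'M[R]_p) (B : 'M[R]_(m, p)),
     A^T = - A /\ xi = col_mx A B].

Definition tangent_ball (r : R) : set 'M[R]_(p + m, p) :=
  [set xi | tangentE xi /\ spectral_norm xi < r].

(* Closed form of the Riemannian exponential at E for the canonical metric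
   g_U(xi, D) = \tr (xi^T (1 - 2^-1 U U^T) D). *)
Definition Exp_canonical (xi : 'M[R]_(p + m, p)) : 'M[R]_(p + m, p) :=
  let A := usubmx xi in
  let B := dsubmx xi in
  expm (block_mx A (- B^T) B 0) *m stiefelE.

End Stiefel.

(* Main.v *)
(* Let [X] be the skew matrix [block_mx A (- B^T) B 0]. If [c < pi / 4 < 1] bounds
   the spectral norm of [col_mx A B], then [|X y|^2 <= 2 c^2 |y|^2], so the norm of
   [X] is less than [sqrt 2]. Since [exp(X)] is orthogonal and the chord from [v] to
   [exp(X) v] is not longer than the arc [s |-> exp(s X) v],
   [|v|^2 - v . exp(X) v = |exp(X) v - v|^2 / 2 <= c^2 |v|^2 < |v|^2],
   whence [v . exp(X) v > 0] for [v != 0]. The quadratic form of the upper block of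
   [U] is thus positive, which excludes the real eigenvalues [0] and [-1]. *)
Require Import Defs.
From mathcomp Require Import ring lra.

Local Open Scope classical_set_scope.
Local Open Scope ring_scope.

(** * Convergence of the matrix exponential series *)

Lemma cvg_mx {R : realType} {k l : nat} (u : nat -> 'M[R]_(k, l)) (L : 'M[R]_(k, l)) :
  (forall i j, (fun n => u n i j) @ \oo --> L i j) -> u @ \oo --> L.
Proof.
move=> uL A [P LP PA].
have : \forall n \near \oo, forall ij : 'I_k * 'I_l, P ij.1 ij.2 (u n ij.1 ij.2).
  by apply: filter_forall => -[i j]; exact: (uL i j _ (LP i j)).
by apply: filterS => n Pn; apply: PA => i j; exact: (Pn (i, j)).
Qed.

Lemma cvg_mulmx_entry {R : realType} {a k l b : nat} (Y : 'M[R]_(a, k))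
    (Z : 'M[R]_(l, b)) (u : nat -> 'M[R]_(k, l)) (L : 'M[R]_(k, l)) i j :
  u @ \oo --> L ->
  (fun n => (Y *m u n *m Z) i j) @ \oo --> (Y *m L *m Z) i j.
Proof.
move=> uL; rewrite mxE; under eq_cvg do rewrite mxE.
apply: cvg_big => [|h _]; first exact: add_continuous.
apply: cvgMl; rewrite mxE; under eq_cvg do rewrite mxE.
apply: cvg_big => [|g _]; first exact: add_continuous.
by apply: cvgMr; exact: cvg_comp uL (@coord_continuous _ _ _ g h L).
Qed.

(** The sum of the absolute values of all entries is submultiplicative, so the entries of
    [Y *m X ^+ n] grow at most geometrically in [n]. *)
Lemma normr_mulmx_expr {R : realType} {a k : nat} (Y : 'M[R]_(a, k))
    (X : 'M[R]_k) (n : nat) (i : 'I_a) (j : 'I_k) :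
  `|(Y *m X ^+ n) i j| <= (\sum_i \sum_j `|Y i j|) * (\sum_i \sum_j `|X i j|) ^+ n.
Proof.
elim: n j => [|n IHn] j.
  rewrite expr0 mulmx1 mulr1 (bigD1 i)//= (bigD1 j)//= -addrA lerDl.
  by rewrite addr_ge0// !sumr_ge0// => ? _; rewrite sumr_ge0.
rewrite exprSr -mulmxE mulmxA mxE (le_trans (ler_norm_sum _ _ _))// exprSr mulrA.
rewrite [leRHS]mulr_sumr; apply: ler_sum => h _; rewrite normrM ler_pM//.
by rewrite (bigD1 j)//= lerDl sumr_ge0.
Qed.

Lemma is_cvg_pseries_mx {R : realType} {a k b : nat} (Y : 'M[R]_(a, k))
    (X : 'M[R]_k) (Z : 'M[R]_(k, b)) i j (s : R) :
  cvgn (pseries (fun n => n`!%:R^-1 * (Y *m X ^+ n *m Z) i j) s).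
Proof.
pose C : R := \sum_i \sum_j `|Y i j|; pose K : R := \sum_i \sum_j `|X i j|.
pose D : R := \sum_h `|Z h j|.
have C0 : 0 <= C by rewrite !sumr_ge0// => ? _; rewrite sumr_ge0.
have K0 : 0 <= K by rewrite !sumr_ge0// => ? _; rewrite sumr_ge0.
have D0 : 0 <= D by rewrite sumr_ge0.
apply: normed_cvg.
(* Comparison with [C * D] times the scalar exponential series at [K * |s|]. *)
apply: (@series_le_cvg _ _ ((C * D) *: exp_coeff (K * `|s|))) => [n|n|n|] //=.
- by rewrite /exp_coeff !fctE !mulr_ge0// exprn_ge0// mulr_ge0.
- rewrite -[leRHS]/(C * D * ((K * `|s|) ^+ n / n`!%:R)).
  rewrite !normrM normfV normr_nat normrX exprMn.
  rewrite [leRHS](_ : _ = n`!%:R^-1 * ((C * K ^+ n) * D) * `|s| ^+ n); last by ring.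
  rewrite ler_wpM2r ?exprn_ge0// ler_wpM2l// mxE (le_trans (ler_norm_sum _ _ _))//.
  rewrite mulr_sumr ler_sum// => h _; rewrite normrM ler_wpM2r//.
  exact: normr_mulmx_expr.
- exact/is_cvg_seriesZ/is_cvg_series_exp_coeff.
Qed.

(** [expm] is a [limn], meaningful only once convergence is known; the limit is built entrywise from
    scalar power series at 1. *)
Lemma cvg_expm {R : realType} {k : nat} (X : 'M[R]_k) :
  series (fun n => n`!%:R^-1 *: X ^+ n) @ \oo --> expm X.
Proof.
pose L : 'M[R]_k := \matrix_(i, j)
  limn (pseries (fun n => n`!%:R^-1 * (1%:M *m X ^+ n *m 1%:M) i j) 1).
suff cL : series (fun n => n`!%:R^-1 *: X ^+ n) @ \oo --> L.
  by rewrite /expm; rewrite (cvg_lim _ cL)//; exact: norm_hausdorff.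
apply: cvg_mx => i j; rewrite mxE.
rewrite [X in X @ _ --> _](_ : _ =
    pseries (fun n => n`!%:R^-1 * (1%:M *m X ^+ n *m 1%:M) i j) 1).
  exact: is_cvg_pseries_mx.
apply/funext => n; rewrite /pseries !seriesEnat/= summxE.
by apply: eq_bigr => h _; rewrite mul1mx mulmx1 mxE expr1n mulr1.
Qed.

Lemma exprmxZ {R : comPzRingType} {k : nat} (s : R) (X : 'M[R]_k) (n : nat) :
  (s *: X) ^+ n = s ^+ n *: X ^+ n.
Proof.
elim: n => [|n IHn]; first by rewrite !expr0 scale1r.
by rewrite !exprS -!mulmxE IHn -scalemxAl -scalemxAr scalerA.
Qed.

(** Reduces calculus on [expm (s *: X)] to scalar power series in [s]. The outer factors cover both
    entries and bilinear forms. *)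
Lemma expmZ_pseries {R : realType} {a k b : nat} (Y : 'M[R]_(a, k))
    (X : 'M[R]_k) (Z : 'M[R]_(k, b)) i j (s : R) :
  (Y *m expm (s *: X) *m Z) i j =
  limn (pseries (fun n => n`!%:R^-1 * (Y *m X ^+ n *m Z) i j) s).
Proof.
apply/esym/cvg_lim => //.
rewrite [X in X @ _ --> _](_ : _ = fun n =>
    (Y *m series (fun n => n`!%:R^-1 *: (s *: X) ^+ n) n *m Z) i j).
  exact/cvg_mulmx_entry/cvg_expm.
apply/funext => n; rewrite /pseries !seriesEnat/= mulmx_sumr mulmx_suml summxE.
apply: eq_bigr => h _.
by rewrite exprmxZ -!scalemxAr -!scalemxAl !mxE; ring.
Qed.

(** * Derivative and orthogonality of the exponential *)

Lemma is_derive_expmZ {R : realType} {a k b : nat} (Y : 'M[R]_(a, k))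
    (X : 'M[R]_k) (Z : 'M[R]_(k, b)) i j (s : R) :
  is_derive s (1 : R) (fun s : R => (Y *m expm (s *: X) *m Z) i j)
    ((Y *m X *m expm (s *: X) *m Z) i j).
Proof.
pose c Y n : R := n`!%:R^-1 * (Y *m X ^+ n *m Z) i j.
(* Since [(n+1) / (n+1)! = 1 / n!], formal differentiation only moves one factor [X] into [Y]. *)
have dc Y' : pseries_diffs (c Y') = c (Y' *m X).
  apply/funext => n; rewrite /pseries_diffs /c factS natrM invfM exprS.
  by rewrite -mulmxE mulmxA !mulrA divff// mul1r.
rewrite expmZ_pseries -/(c _) -dc.
rewrite (_ : (fun _ => _) = fun s => limn (pseries (c Y) s)); last first.
  by apply/funext => r; rewrite expmZ_pseries.
(* Termwise differentiation at [s] needs convergence at a point of larger modulus. *)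
apply: (@pseries_snd_diffs _ _ (`|s| + 1)); rewrite ?dc; try exact: is_cvg_pseries_mx.
by rewrite [ltRHS]ger0_norm ?addr_ge0// ltrDl.
Qed.

Lemma expm0 {R : realType} {k : nat} : expm (0 : 'M[R]_k) = 1%:M.
Proof.
apply: lim_near_cst; first exact: norm_hausdorff.
(* The partial sums equal 1 only from [n = 1] on: the empty one is 0. *)
near=> n; rewrite seriesEnat/= -[n]prednK; last by near: n; exists 1%N.
rewrite big_nat_recl//= big1 ?addr0; first by rewrite fact0 invr1 scale1r expr0.
by move=> i _; rewrite expr0n/= scaler0.
Unshelve. all: by end_near. Qed.

(** With [E = expm (s *: X)], the derivative of [E^T *m E] is [E^T (X^T + X) E = 0], so the product
    keeps its value at [s = 0]. *)
Lemma expm_skew_orthogonal {R : realType} {k : nat} (X : 'M[R]_k) (s : R) :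
  X^T = - X -> (expm (s *: X))^T *m expm (s *: X) = 1%:M.
Proof.
move=> skX; apply/matrixP => i j.
pose e (j h : 'I_k) (s : R) : R := (expm (s *: X)) h j.
pose g (s : R) : R := ((expm (s *: X))^T *m expm (s *: X)) i j.
suff gE : g s = g 0 by rewrite -[LHS]/(g s) gE /g scale0r expm0 trmx1 mulmx1.
have de h l (r : R) : is_derive r (1 : R) (e l h) ((X *m expm (r *: X)) h l).
  have := is_derive_expmZ 1%:M X 1%:M h l r.
  rewrite (_ : (fun _ => _) = e l h) ?mulmx1 ?mul1mx//.
  by apply/funext => t; rewrite mulmx1 mul1mx.
have -> : g = \sum_(h < k) (e i h * e j h).
  apply/funext => r; rewrite /g mxE fct_sumE.
  by apply: eq_bigr => h _; rewrite mxE.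
apply: is_derive_0_is_cst => r.
apply: is_derive_eq.
set E := expm (r *: X).
transitivity ((E^T *m X^T *m E + E^T *m (X *m E)) i j).
  rewrite -trmx_mul mxE [X in _ = X + _]mxE [X in _ = _ + X]mxE -big_split/=.
  apply: eq_bigr => h _; rewrite addrC !mxE; congr (_ + _).
  by rewrite mulrC.
by rewrite skX mulmxN mulNmx mulmxA addNr mxE.
Qed.

(** * The Euclidean inner product *)

Definition dotc {R : comPzRingType} {k : nat} (u v : 'cV[R]_k) : R := (u^T *m v) 0 0.

Lemma dotcE {R : comPzRingType} {k : nat} (u v : 'cV[R]_k) :
  dotc u v = \sum_i u i 0 * v i 0.
Proof. by rewrite /dotc mxE; apply: eq_bigr => i _; rewrite mxE. Qed.

Lemma dotcC {R : comPzRingType} {k : nat} (u v : 'cV[R]_k) : dotc u v = dotc v u.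
Proof. by rewrite !dotcE; apply: eq_bigr => i _; rewrite mulrC. Qed.

Lemma dotcDl {R : comPzRingType} {k : nat} (u v w : 'cV[R]_k) :
  dotc (u + v) w = dotc u w + dotc v w.
Proof. by rewrite /dotc linearD mulmxDl mxE. Qed.

Lemma dotcZl {R : comPzRingType} {k : nat} (a : R) (u v : 'cV[R]_k) :
  dotc (a *: u) v = a * dotc u v.
Proof. by rewrite /dotc linearZ/= -scalemxAl mxE. Qed.

Lemma dotcDr {R : comPzRingType} {k : nat} (u v w : 'cV[R]_k) :
  dotc w (u + v) = dotc w u + dotc w v.
Proof. by rewrite dotcC dotcDl !(dotcC w). Qed.

Lemma dotcZr {R : comPzRingType} {k : nat} (a : R) (u v : 'cV[R]_k) :
  dotc u (a *: v) = a * dotc u v.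
Proof. by rewrite dotcC dotcZl dotcC. Qed.

Lemma dotc_mulmxl {R : comPzRingType} {k l : nat} (M : 'M[R]_(k, l)) u v :
  dotc (M *m u) v = dotc u (M^T *m v).
Proof. by rewrite /dotc trmx_mul mulmxA. Qed.

Lemma dotc_col_mx {R : comPzRingType} {k l : nat} (a c : 'cV[R]_k) (b d : 'cV[R]_l) :
  dotc (col_mx a b) (col_mx c d) = dotc a c + dotc b d.
Proof. by rewrite /dotc tr_col_mx mul_row_col mxE. Qed.

Lemma dotc_ge0 {R : realDomainType} {k : nat} (u : 'cV[R]_k) : 0 <= dotc u u.
Proof. by rewrite dotcE sumr_ge0// => i _; rewrite -expr2 sqr_ge0. Qed.

Lemma dotc_gt0 {R : realDomainType} {k : nat} (u : 'cV[R]_k) : u != 0 -> 0 < dotc u u.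
Proof.
move=> u0; rewrite lt_def dotc_ge0 andbT; apply: contra u0 => /eqP.
rewrite dotcE => /psumr_eq0P u0; apply/eqP/colP => i; rewrite mxE.
by apply/eqP; rewrite -sqrf_eq0 expr2 u0// => j _; rewrite -expr2 sqr_ge0.
Qed.

Lemma Cauchy_Schwarz_dotc {R : realDomainType} {k : nat} (u v : 'cV[R]_k) :
  dotc u v ^+ 2 <= dotc u u * dotc v v.
Proof.
have [->|/dotc_gt0 v0] := eqVneq v 0.
  by rewrite dotcC -(scale0r (0 : 'cV_k)) !dotcZl !mul0r mulr0 expr0n.
(* The squared length of this vector is [c * (a * c - b ^+ 2)] in the notation below; no division is
   required. *)
have := dotc_ge0 (dotc v v *: u + (- dotc u v) *: v).
rewrite dotcDl !dotcDr !dotcZl !dotcZr (dotcC v u).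
set a := dotc u u; set b := dotc u v; set c := dotc v v => h.
have : 0 <= c * (a * c - b ^+ 2) by move: h; congr (_ <= _); ring.
by rewrite pmulr_rge0// subr_ge0.
Qed.

(** * Quadratic bounds from the spectral norm *)

(* The entries of [M *m x] are controlled by Cauchy-Schwarz, so the set whose
   supremum is the spectral norm is bounded and the supremum is genuine. *)
Lemma has_ubound_spectral {R : realType} {k l : nat} (M : 'M[R]_(k, l)) :
  has_ubound [set enorm (M *m x) | x in [set x : 'cV[R]_l | enorm x <= 1]].
Proof.
pose C : R := \sum_i dotc (row i M)^T (row i M)^T.
exists (Num.sqrt C) => _ [x /= x1 <-]; rewrite /enorm ler_sqrt; last first.
  by rewrite sumr_ge0// => i _; exact: dotc_ge0.
have {}x1 : dotc x x <= 1.
  by rewrite dotcE; move: x1; rewrite /enorm -[X in _ <= X -> _]sqrtr1 ler_sqrt//.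
apply: ler_sum => i _.
have -> : (M *m x) i 0 = dotc (row i M)^T x.
  by rewrite mxE dotcE; apply: eq_bigr => j _; rewrite !mxE.
by rewrite (le_trans (Cauchy_Schwarz_dotc _ _))// ler_piMr// dotc_ge0.
Qed.

Lemma enormE {R : realType} {k : nat} (x : 'cV[R]_k) : enorm x = Num.sqrt (dotc x x).
Proof. by rewrite dotcE. Qed.

Lemma spectral_norm_ge0 {R : realType} {k l : nat} (M : 'M[R]_(k, l)) :
  0 <= spectral_norm M.
Proof.
apply: ub_le_sup; first exact: has_ubound_spectral.
have e0 n : enorm (0 : 'cV[R]_n) = 0.
  by rewrite enormE /dotc mulmx0 mxE sqrtr0.
by exists 0; rewrite /= ?mulmx0 e0.
Qed.

Lemma dotc_mulmx_le {R : realType} {k l : nat} (M : 'M[R]_(k, l)) (x : 'cV[R]_l) :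
  dotc (M *m x) (M *m x) <= spectral_norm M ^+ 2 * dotc x x.
Proof.
have [->|/dotc_gt0 x0] := eqVneq x 0; first by rewrite /dotc !mulmx0 mxE mulr0.
pose r := Num.sqrt (dotc x x).
have r0 : 0 < r by rewrite sqrtr_gt0.
have r2 : r ^+ 2 = dotc x x by rewrite sqr_sqrtr// ltW.
have : enorm (M *m (r^-1 *: x)) <= spectral_norm M.
  apply: ub_le_sup; first exact: has_ubound_spectral.
  exists (r^-1 *: x) => //=.
  by rewrite enormE dotcZl dotcZr mulrA -expr2 exprVn r2 mulVf ?sqrtr1// gt_eqF.
rewrite -scalemxAr enormE -[leRHS]ger0_norm ?spectral_norm_ge0// -[leRHS]sqrtr_sqr.
rewrite ler_sqrt ?sqr_ge0// dotcZl dotcZr mulrA -expr2 exprVn r2 mulrC.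
by rewrite ler_pdivrMr.
Qed.

(** For [z = M^T y], [|z|^2 = (M z) . y]; Cauchy-Schwarz gives [|z|^4 <= c |z|^2 |y|^2], and [|z|^2]
    cancels. *)
Lemma dotc_trmx_mulmx_le {R : realDomainType} {k l : nat} (M : 'M[R]_(k, l)) (c : R) :
  0 <= c -> (forall x, dotc (M *m x) (M *m x) <= c * dotc x x) ->
  forall y, dotc (M^T *m y) (M^T *m y) <= c * dotc y y.
Proof.
move=> c0 Mc y; set z := M^T *m y.
have [->|/dotc_gt0 z0] := eqVneq z 0.
  by rewrite {1}/dotc mulmx0 mxE mulr_ge0// dotc_ge0.
have zE : dotc (M *m z) y = dotc z z by exact: dotc_mulmxl.
rewrite -(ler_pM2l z0) -expr2 -{1}zE.
rewrite (le_trans (Cauchy_Schwarz_dotc _ _))// mulrA (mulrC (dotc z z)).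
by rewrite ler_wpM2r// dotc_ge0.
Qed.

Lemma dotcD_le {R : realDomainType} {k : nat} (u v : 'cV[R]_k) :
  dotc (u + v) (u + v) <= 2 * (dotc u u + dotc v v).
Proof.
(* Parallelogram law, dropping [|u - v|^2]. *)
have := dotc_ge0 (u + (-1) *: v).
rewrite !dotcDl !dotcDr !dotcZl !dotcZr (dotcC v u); lra.
Qed.

(* [block_mx A (- B^T) B 0] maps [col_mx a b] to [xi *m a - col_mx (B^T *m b) 0],
   and both summands are bounded by the operator norm of [xi = col_mx A B]. *)
Lemma dotc_block_mx_le {R : realDomainType} {p m : nat} (A : 'M[R]_p)
    (B : 'M[R]_(m, p)) (c : R) :
  0 <= c ->
  (forall x, dotc (col_mx A B *m x) (col_mx A B *m x) <= c * dotc x x) ->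
  forall y, dotc (block_mx A (- B^T) B 0 *m y) (block_mx A (- B^T) B 0 *m y)
    <= (2 * c) * dotc y y.
Proof.
move=> c0 ABc y; rewrite -[y]vsubmxK; set a := usubmx y; set b := dsubmx y.
have Bc x : dotc (B *m x) (B *m x) <= c * dotc x x.
  by apply: le_trans (ABc x); rewrite mul_col_mx dotc_col_mx lerDr dotc_ge0.
have -> : block_mx A (- B^T) B 0 *m col_mx a b =
    col_mx A B *m a + (-1) *: col_mx (B^T *m b) 0.
  rewrite mul_block_col mul_col_mx scale_col_mx add_col_mx.
  by rewrite mul0mx scaler0 mulNmx scaleN1r.
rewrite (le_trans (dotcD_le _ _))// -mulrA ler_pM2l// [dotc (col_mx a b) _]dotc_col_mx.
rewrite mulrDr lerD// dotcZl dotcZr mulrA mulrNN mulr1 mul1r dotc_col_mx.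
rewrite {2}/dotc mulmx0 mxE addr0.
exact: dotc_trmx_mulmx_le.
Qed.

Lemma dotc_expm_skew_gt0 {R : realType} {k : nat} (X : 'M[R]_k) (c : R) :
  X^T = - X -> c < 2 ->
  (forall y, dotc (X *m y) (X *m y) <= c * dotc y y) ->
  forall v, v != 0 -> 0 < dotc v (expm X *m v).
Proof.
move=> skX c2 Xc v /dotc_gt0 v0.
have isoE s (u : 'cV[R]_k) :
    dotc (expm (s *: X) *m u) (expm (s *: X) *m u) = dotc u u.
  by rewrite dotc_mulmxl mulmxA expm_skew_orthogonal// mul1mx.
have isoE1 := isoE 1 v; rewrite scale1r in isoE1.
pose w := expm X *m v + (-1) *: v.
(* The mean value theorem along the fixed direction [w] replaces the arc length integral. *)
have [s _] : exists2 s : R, s \in `[0, 1] &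
    dotc w (expm (1 *: X) *m v) - dotc w (expm (0 *: X) *m v) =
    dotc w (X *m (expm (s *: X) *m v)) * (1 - 0).
  have df (s : R) : is_derive s (1 : R) (fun s : R => dotc w (expm (s *: X) *m v))
      (dotc w (X *m (expm (s *: X) *m v))).
    have := is_derive_expmZ w^T X v 0 0 s; rewrite -!mulmxA.
    rewrite (_ : (fun _ => _) = fun s => dotc w (expm (s *: X) *m v))//.
    by apply/funext => r; rewrite /dotc mulmxA.
  apply: (MVT_segment ler01 (fun s _ => df s)).
  by apply: derivable_within_continuous => s _; have [] := df s.
rewrite scale1r scale0r expm0 mul1mx subr0 mulr1 => ws.
have ww : dotc w w = dotc w (X *m (expm (s *: X) *m v)).
  by rewrite -ws {2}/w dotcDr dotcZr mulN1r.
(* Cauchy-Schwarz, the bound on [X], and the isometry [|exp(sX) v| = |v|]. *)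
have w2 : dotc w w ^+ 2 <= dotc w w * (c * dotc v v).
  rewrite {1}ww (le_trans (Cauchy_Schwarz_dotc _ _))// ler_wpM2l ?dotc_ge0//.
  by rewrite -(isoE s v); exact: Xc.
have wE : dotc w w = 2 * (dotc v v - dotc v (expm X *m v)).
  rewrite /w !dotcDl !dotcDr !dotcZl !dotcZr isoE1 (dotcC (expm X *m v) v); ring.
(* If the chord vanishes, [v . exp(X) v = |v|^2 > 0]; otherwise [|w|^2] can be cancelled. *)
have [w0|w0] := eqVneq (dotc w w) 0.
  by move: wE; rewrite w0; lra.
have wc : dotc w w <= c * dotc v v.
  by rewrite -(ler_pM2l (_ : 0 < dotc w w)) -?expr2// lt_def w0 dotc_ge0.
have : c * dotc v v < 2 * dotc v v by rewrite ltr_pM2r.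
lra.
Qed.

Theorem theorem3p14 (R : realType) (p m : nat) (hp : (0 < p)%N)
    (t : R) (ht : 0 <= t <= 1)
    (xi : 'M[R]_(p + m, p)) (hxi : tangent_ball (pi / 4) xi) :
  let U := Exp_canonical (t *: xi) in
  [/\ stiefel U,
      usubmx U \in unitmx
    & ~~ eigenvalue (usubmx U) (-1)].
Proof.
case: hxi => -[A [B [skA ->]]] normxi U.
set c := spectral_norm _ in normxi.
have c0 : 0 <= c := spectral_norm_ge0 _.
have c1 : c < 1.
  (* [pi / 2 < 2] means [pi / 4 < 1]. *)
  by have := pihalf_lt2 R; lra.
pose X := block_mx (t *: A) (- (t *: B)^T) (t *: B) 0 : 'M[R]_(p + m).
have UE : U = expm X *m stiefelE R p m.
  by rewrite /U /Exp_canonical scale_col_mx col_mxKu col_mxKd.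
have skX : X^T = - X.
  rewrite /X tr_block_mx opp_block_mx linearN/= trmxK trmx0 oppr0 opprK.
  by rewrite linearZ/= skA scalerN.
have XX y : dotc (X *m y) (X *m y) <= (2 * c ^+ 2) * dotc y y.
  apply: dotc_block_mx_le => [|x]; first exact: sqr_ge0.
  rewrite -scale_col_mx -scalemxAl dotcZl dotcZr.
  apply: le_trans (dotc_mulmx_le _ _).
  case/andP: ht => t0 t1; rewrite mulrA ler_piMl ?dotc_ge0//.
  by rewrite mulr_ile1.
have EE : (expm X)^T *m expm X = 1%:M.
  by have := expm_skew_orthogonal X 1 skX; rewrite scale1r.
(* Row vectors, because [det0P] and [eigenvalueP] provide left null vectors and left
   eigenvectors. *)
have posU (z : 'rV[R]_p) : z != 0 -> 0 < (z *m usubmx U *m z^T) 0 0.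
  move=> z0.
  (* Padding [z^T] with zeros turns the form of the upper block into that of [expm X]. *)
  have -> : z *m usubmx U *m z^T = (col_mx z^T 0)^T *m (expm X *m col_mx z^T 0).
    have -> : col_mx z^T 0 = stiefelE R p m *m z^T.
      by rewrite mul_col_mx mul1mx mul0mx.
    rewrite trmx_mul trmxK !mulmxA -(mulmxA _ (expm X)) -UE; congr (_ *m _).
    rewrite -mulmxA -{2}[U]vsubmxK /stiefelE tr_col_mx trmx1 trmx0.
    by rewrite mul_row_col mul1mx mul0mx addr0.
  rewrite -/(dotc _ _); apply: (dotc_expm_skew_gt0 _ (2 * c ^+ 2)) => //.
    by rewrite -[ltRHS]mulr1 ltr_pM2l// expr_lt1.
  rewrite -col_mx0; apply: contra z0 => /eqP/eq_col_mx[z0 _].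
  by rewrite -[z]trmxK z0 trmx0.
split.
- rewrite /stiefel/= UE trmx_mul mulmxA -(mulmxA _ _ (expm X)) EE mulmx1.
  by rewrite /stiefelE tr_col_mx mul_row_col trmx1 trmx0 mul1mx mul0mx addr0.
- rewrite unitmxE unitfE; apply/negP => /det0P[z /posU + zU].
  by rewrite zU mul0mx mxE ltxx.
(* A left eigenvector for -1 would give the form the value [-|z|^2], contradicting positivity. *)
- apply/negP => /eigenvalueP[z zU z0]; have := posU z z0.
  rewrite zU -scalemxAl mxE mulN1r oppr_gt0 ltNge.
  by have := dotc_ge0 z^T; rewrite /dotc trmxK => ->.
Qed.
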